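(* Let $M$ be the complement of the figure-eight knot. For each $\gamma=p\alpha+q\lambda\in H_1(\partial M,\mathbb{Z})$, the Culler-Shalen norm of $\gamma$ is $$|\gamma|=|(p,q)|=2\bigl(|p+4q|+|p-4q|\bigr).$$
   Context: $M$ is the complement in $S^3$ of the figure-eight knot, with $$\pi_1(M)=\langle\alpha,\beta\mid\beta^{-1}\alpha^{-1}\beta\alpha\beta^{-1}\alpha\beta\alpha^{-1}\beta^{-1}\alpha\rangle,$$ where $\alpha,\beta$ are meridians. A peripheral subgroup $\pi_1(\partial M)=H_1(\partial M,\mathbb{Z})\cong\mathbb{Z}\oplus\mathbb{Z}$ is generated by the meridian $\alpha$ and the longitude $\lambda=\beta^{-1}\alpha\beta\alpha^{-1}\alpha^{-1}\beta\alpha\beta^{-1}$. $X_0$ is the irreducible component of the $SL_2(\mathbb{C})$-character variety $X(M)$ containing the characters of the discrete faithful representations of the complete hyperbolic structure; it is an affine curve, and $\widetilde{X_0}$ denotes its smooth projective model. For $\gamma\in H_1(\partial M,\mathbb{Z})$ let $I_\gamma(\chi)=\chi(\gamma)$ and $f_\gamma=I_\gamma^2-4$ on $X_0$, regarded as a meromorphic function (a holomorphic map to $\mathbb{CP}^1$) on $\widetilde{X_0}$. The Culler-Shalen norm $|\cdot|$ is the norm on $H_1(\partial M,\mathbb{R})$ with $|\gamma|=\deg f_\gamma$ for every $\gamma\in H_1(\partial M,\mathbb{Z})$. *)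

(* Defs.v *)
From HB Require Import structures.
From mathcomp Require Import all_boot all_order all_algebra.
From mathcomp Require Import generic_quotient fraction.
From mathcomp Require Import complex.
From mathcomp Require Import boolp classical_sets functions reals ereal esum.

Set Implicit Arguments.
Unset Strict Implicit.
Unset Printing Implicit Defensive.

Import Order.TTheory GRing.Theory Num.Theory.

Local Open Scope classical_set_scope.
Local Open Scope quotient_scope.
Local Open Scope ring_scope.

(* A word is a list of letters (g, e): g = false is alpha, g = true is beta,
   and e = true marks the inverse of the generator. *)
Definition word := seq (bool * bool).

Local Notation a := (false, false).
Local Notation a' := (false, true).
Local Notation b := (true, false).
Local Notation b' := (true, true).

Definition fig8_relator : word := [:: b'; a'; b; a; b'; a; b; a'; b'; a].

Definition longitude_word : word := [:: b'; a; b; a'; a'; b; a; b'].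

Inductive word_equiv : word -> word -> Prop :=
| word_equiv_refl u : word_equiv u u
| word_equiv_sym u v : word_equiv u v -> word_equiv v u
| word_equiv_trans u v w : word_equiv u v -> word_equiv v w -> word_equiv u w
| word_equiv_cat u u' v v' :
    word_equiv u u' -> word_equiv v v' -> word_equiv (u ++ v) (u' ++ v')
| word_equiv_cancel g e : word_equiv [:: (g, e); (g, ~~ e)] [::]
| word_equiv_relator : word_equiv fig8_relator [::].

Definition word_equivb (u v : word) : bool := `[< word_equiv u v >].

Lemma word_equivb_refl : reflexive word_equivb.
Proof. by move=> u; apply/asboolP; constructor. Qed.

Lemma word_equivb_sym : symmetric word_equivb.
Proof.
by move=> u v; apply/idP/idP => /asboolP uv; apply/asboolP;
  apply: word_equiv_sym.
Qed.

Lemma word_equivb_trans : transitive word_equivb.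
Proof.
by move=> v u w /asboolP uv /asboolP vw; apply/asboolP;
  apply: word_equiv_trans vw.
Qed.

Canonical word_equiv_rel :=
  EquivRel word_equivb word_equivb_refl word_equivb_sym word_equivb_trans.

Definition fig8_group := {eq_quot word_equivb}.

HB.instance Definition _ := EqQuotient.on fig8_group.
HB.instance Definition _ := Choice.on fig8_group.

Definition of_word (w : word) : fig8_group := \pi_(fig8_group) w.

Definition word_inv (w : word) : word := rev [seq (x.1, ~~ x.2) | x <- w].

Definition fig8_mul (x y : fig8_group) : fig8_group :=
  of_word (repr x ++ repr y).
Definition fig8_inv (x : fig8_group) : fig8_group := of_word (word_inv (repr x)).

Lemma of_wordP u v : of_word u = of_word v <-> word_equiv u v.
Proof.
split=> [/eqquotP/asboolP //|uv]; exact/eqquotP/asboolP.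
Qed.

Lemma repr_of_word u : word_equiv (repr (of_word u)) u.
Proof. by apply/of_wordP; rewrite /of_word reprK. Qed.

Lemma of_word_repr x : of_word (repr x) = x.
Proof. exact: reprK. Qed.

Lemma of_word_cat u v : fig8_mul (of_word u) (of_word v) = of_word (u ++ v).
Proof. by apply/of_wordP/word_equiv_cat; apply: repr_of_word. Qed.

Lemma word_invV u : word_equiv (word_inv u ++ u) [::].
Proof.
rewrite /word_inv; elim: u => [|[g e] u IHu] /=; first by constructor.
rewrite rev_cons cat_rcons; apply: word_equiv_trans IHu.
apply: word_equiv_cat; first by constructor.
rewrite -[X in word_equiv _ X]cat0s -cat1s -[(g, e) :: u]cat1s catA.
apply: word_equiv_cat; last by constructor.
by rewrite /= -{2}[e]negbK; constructor.
Qed.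

Lemma word_invK : involutive word_inv.
Proof.
move=> u; rewrite /word_inv map_rev revK -map_comp -[RHS]map_id.
by apply: eq_map => -[g e] /=; rewrite negbK.
Qed.

Lemma fig8_mulA : associative fig8_mul.
Proof.
move=> x y z; rewrite -(of_word_repr x) -(of_word_repr y) -(of_word_repr z).
by rewrite !of_word_cat catA.
Qed.

Lemma fig8_mul1g : left_id (of_word [::]) fig8_mul.
Proof. by move=> x; rewrite -(of_word_repr x) of_word_cat. Qed.

Lemma fig8_mulg1 : right_id (of_word [::]) fig8_mul.
Proof. by move=> x; rewrite -(of_word_repr x) of_word_cat cats0. Qed.

Lemma fig8_mulVg : left_inverse (of_word [::]) fig8_inv fig8_mul.
Proof.
move=> x; rewrite -{2}(of_word_repr x) of_word_cat.
exact/of_wordP/word_invV.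
Qed.

Lemma fig8_mulgV : right_inverse (of_word [::]) fig8_inv fig8_mul.
Proof.
move=> x; rewrite -{1}(of_word_repr x) of_word_cat; apply/of_wordP.
by rewrite -{1}(word_invK (repr x)); apply: word_invV.
Qed.

HB.instance Definition _ := isGroup.Build fig8_group
  fig8_mulA fig8_mul1g fig8_mulg1 fig8_mulVg fig8_mulgV.

Definition meridian : fig8_group := of_word [:: a].
Definition longitude : fig8_group := of_word longitude_word.

Definition zexpg (g : fig8_group) (n : int) : fig8_group :=
  match n with
  | Posz k => (g ^+ k)%g
  | Negz k => (g ^- k.+1)%g
  end.

(* The class p alpha + q lambda in H_1(dM, Z), as an element of the peripheral
   subgroup generated by the meridian and the longitude. *)
Definition peripheral (p q : int) : fig8_group :=
  (zexpg meridian p * zexpg longitude q)%g.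

Section CharacterVariety.
Variable R : realType.
Local Notation C := R[i].

Definition SL2_representation (rho : fig8_group -> 'M[C]_2) : Prop :=
  (forall g, \det (rho g) = 1) /\
  (forall g h, rho (g * h)%g = rho g *m rho h).

(* Discreteness of the image for the entrywise topology on 2 x 2 matrices.  By
   Mostow-Prasad rigidity these representations are exactly the lifts to SL_2(C)
   of the holonomies of the complete hyperbolic structure. *)
Definition discrete_faithful (rho : fig8_group -> 'M[C]_2) : Prop :=
  [/\ SL2_representation rho,
      injective rho &
      forall g, exists2 eps : R, 0 < eps &
        forall h, (forall i j, `|rho h i j - rho g i j| < (eps%:C)%C) ->
          rho h = rho g].

Definition character_of (rho : fig8_group -> 'M[C]_2) : fig8_group -> C :=
  fun g => \tr (rho g).

Definition character_variety : set (fig8_group -> C) :=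
  [set chi | exists2 rho, SL2_representation rho & chi = character_of rho].

(* Polynomials in the functions I_g : chi |-> chi g.  On the character
   variety finitely many of the I_g
   generate this algebra; using all of them avoids choosing coordinates. *)
Inductive trace_polynomial : ((fig8_group -> C) -> C) -> Prop :=
| trace_polynomial_const c : trace_polynomial (fun=> c)
| trace_polynomial_I g : trace_polynomial (fun chi => chi g)
| trace_polynomial_add F G : trace_polynomial F -> trace_polynomial G ->
    trace_polynomial (fun chi => F chi + G chi)
| trace_polynomial_mul F G : trace_polynomial F -> trace_polynomial G ->
    trace_polynomial (fun chi => F chi * G chi).

Definition zariski_closed (Z : set (fig8_group -> C)) : Prop :=
  exists2 S : set ((fig8_group -> C) -> C), S `<=` trace_polynomial &
    Z = [set chi | character_variety chi /\ forall F, S F -> F chi = 0].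

Definition irreducible_closed (Z : set (fig8_group -> C)) : Prop :=
  [/\ zariski_closed Z, Z !=set0 &
      forall Z1 Z2, zariski_closed Z1 -> zariski_closed Z2 ->
        Z = Z1 `|` Z2 -> Z = Z1 \/ Z = Z2].

Record subvariety := Subvariety {
  points :> set (fig8_group -> C);
  points_irreducible : irreducible_closed points }.

Definition irreducible_component (X : subvariety) : Prop :=
  forall Y : subvariety, points X `<=` points Y -> points Y = points X.

Definition canonical_component (X : subvariety) : Prop :=
  irreducible_component X /\
  exists2 rho, discrete_faithful rho & points X (character_of rho).

Section Subvariety.
Variable X : subvariety.

Definition is_regular : {pred set_type X -> C} :=
  fun f => `[< exists2 F, trace_polynomial F & f = fun x => F (\val x) >].

Lemma is_regular_subring : subring_closed is_regular.
Proof.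
split=> [|f g /asboolP[F FP ->] /asboolP[G GP ->]|
          f g /asboolP[F FP ->] /asboolP[G GP ->]]; apply/asboolP.
- by exists (fun=> 1) => //; constructor.
- exists (fun chi => F chi + (-1) * G chi).
    by do !constructor.
  by apply/funext => x; rewrite mulN1r.
- by exists (fun chi => F chi * G chi) => //; constructor.
Qed.

HB.instance Definition _ :=
  GRing.isSubringClosed.Build (set_type X -> C) is_regular is_regular_subring.

Record coordinate_ring := CoordinateRing {
  regular_fun :> set_type X -> C;
  _ : regular_fun \in is_regular }.

HB.instance Definition _ := [isSub for regular_fun].
HB.instance Definition _ := [Choice of coordinate_ring by <:].
HB.instance Definition _ :=
  GRing.SubChoice_isSubComPzRing.Build (set_type X -> C) is_regular
    coordinate_ring (subringClosedP is_regular).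

Lemma coordinate_ring_nonzero : 1 != 0 :> coordinate_ring.
Proof.
have [_ [x Xx] _] := points_irreducible X.
apply/eqP => /(congr1 regular_fun) /(congr1 (fun f => f (SigSub (mem_set Xx)))).
by move/eqP; rewrite /= oner_eq0.
Qed.

HB.instance Definition _ :=
  GRing.PzSemiRing_isNonZero.Build coordinate_ring coordinate_ring_nonzero.

Definition coordinate_unit : {pred coordinate_ring} :=
  fun f => `[< exists g, g * f = 1 >].

Definition coordinate_inv (f : coordinate_ring) : coordinate_ring :=
  match pselect (exists g, g * f = 1) with
  | left fg => projT1 (cid fg)
  | right _ => f
  end.

Lemma coordinate_mulV : {in coordinate_unit, left_inverse 1 coordinate_inv *%R}.
Proof.
move=> f /asboolP fu; rewrite /coordinate_inv; case: pselect => // fg.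
by case: cid.
Qed.

Lemma coordinate_unitP f g : g * f = 1 -> coordinate_unit f.
Proof. by move=> gf; apply/asboolP; exists g. Qed.

Lemma coordinate_inv_out :
  {in [predC coordinate_unit], coordinate_inv =1 id}.
Proof.
move=> f /= /negP fNu; rewrite /coordinate_inv; case: pselect => // fg.
by exfalso; apply: fNu; apply/asboolP.
Qed.

HB.instance Definition _ := GRing.ComNzRing_hasMulInverse.Build coordinate_ring
  coordinate_mulV coordinate_unitP coordinate_inv_out.

Lemma zariski_closed_cut F : trace_polynomial F ->
  zariski_closed (points X `&` [set chi | F chi = 0]).
Proof.
move=> FP; have [[S SP XS] _ _] := points_irreducible X.
exists (S `|` [set F]) => [G [/SP //|->//]|].
rewrite [in LHS]XS; apply/seteqP; split => chi /=.
  by move=> [[chiX chiS] Fchi]; split=> // G [/chiS //|->].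
move=> [chiX chiS]; split; last by apply: chiS; right.
by split=> // G SG; apply: chiS; left.
Qed.

Lemma zariski_closed_cut_eq0 (f : coordinate_ring) F :
  (f : set_type X -> C) = (fun x => F (\val x)) ->
  points X = points X `&` [set chi | F chi = 0] -> f = 0.
Proof.
move=> fF XF; apply: val_inj; apply/funext => x /=; rewrite fF.
have: points X (\val x) by case: x => x /= /set_mem.
by case/seteqP: XF => XF _ /XF[].
Qed.

Lemma coordinate_ring_domain (f g : coordinate_ring) :
  f * g = 0 -> (f == 0) || (g == 0).
Proof.
move=> fg0; have /asboolP[F FP fF] := valP f; have /asboolP[G GP gG] := valP g.
have [_ _ /(_ _ _ (zariski_closed_cut FP) (zariski_closed_cut GP))] :=
  points_irreducible X.
case=> [|XF|XG].
- rewrite -setIUr; apply/seteqP; split=> [chi Xchi|chi [] //]; split=> //=.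
  have /(congr1 (fun h => h (SigSub (mem_set Xchi)))) := congr1 regular_fun fg0.
  rewrite /= /GRing.mul /= fF gG /= => /eqP.
  by rewrite mulf_eq0 => /orP[/eqP|/eqP]; [left|right].
- by rewrite (zariski_closed_cut_eq0 fF XF) eqxx.
- by rewrite (zariski_closed_cut_eq0 gG XG) eqxx orbT.
Qed.

HB.instance Definition _ :=
  GRing.ComUnitRing_isIntegral.Build coordinate_ring coordinate_ring_domain.

Definition function_field := {fraction coordinate_ring}.

Lemma const_regular (c : C) : (fun=> c) \in is_regular.
Proof. by apply/asboolP; exists (fun=> c) => //; constructor. Qed.

Definition const_fun (c : C) : coordinate_ring :=
  CoordinateRing (const_regular c).

Lemma I_regular g :
  (fun x : set_type X => (\val x : fig8_group -> C) g) \in is_regular.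
Proof. by apply/asboolP; exists (fun chi => chi g) => //; constructor. Qed.

Definition I_ (g : fig8_group) : coordinate_ring := CoordinateRing (I_regular g).

Definition f_ (p q : int) : function_field :=
  FracField.tofrac (I_ (peripheral p q) ^+ 2 - 4).

(* The smooth projective model of the curve X, as the set of discrete valuation
   rings of C(X) over C: a point is given by its normalised valuation, the order
   of vanishing at that point.  The value at 0, mathematically +oo, is set to 0
   so that each point is represented by exactly one function. *)
Definition smooth_projective_model : set (function_field -> int) :=
  [set v | [/\ v 0 = 0,
      forall c : C, v (FracField.tofrac (const_fun c)) = 0,
      forall f g, f != 0 -> g != 0 -> v (f * g) = v f + v g,
      forall f g, f != 0 -> g != 0 -> f + g != 0 ->
        Num.min (v f) (v g) <= v (f + g) &
      exists t, v t = 1]].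

(* The degree of a meromorphic function f on the smooth projective model, viewed
   as a map to CP^1: the number of points over oo, i.e. of poles, counted with
   multiplicity.  It is 0 when f is constant. *)
Definition degree (f : function_field) : \bar R :=
  \esum_(v in smooth_projective_model) ((Num.max (- v f) 0)%:~R)%:E.

(* H_1(dM, R) is identified with R * R through the basis (alpha, lambda). *)
Definition is_norm (N : R * R -> R) : Prop :=
  [/\ forall u v, N (u.1 + v.1, u.2 + v.2) <= N u + N v,
      forall c u, N (c * u.1, c * u.2) = `|c| * N u &
      forall u, N u = 0 -> u = (0, 0)].

Definition culler_shalen_norm (N : R * R -> R) : Prop :=
  is_norm N /\
  forall p q : int, (N (p%:~R, q%:~R))%:E = degree (f_ p q).

End Subvariety.
End CharacterVariety.

(* Main.v *)
From HB Require Import structures.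
Require Import Defs.
From mathcomp Require Import all_boot all_order all_algebra.
From mathcomp Require Import reals.
From mathcomp Require Import fraction complex.
From mathcomp Require Import boolp classical_sets ereal esum.
From mathcomp Require Import zify ring.

Set Implicit Arguments.
Unset Strict Implicit.
Unset Printing Implicit Defensive.

Import Order.TTheory GRing.Theory Num.Theory.
Local Open Scope ring_scope.

(** Let [x] be the trace of the meridian [alpha] and [u + 1] the trace of
  [alpha * beta^-1].  In SL_2 the trace of every word in the two conjugate
  meridians is a polynomial in [x] and [u] ([trace_of_word]), and the relator
  forces [(u - 1) * (u * x ^+ 2 - u ^+ 2 - 3 * u - 1) = 0]
  ([character_relation]).  As the coordinate ring is a domain, one of the two
  factors vanishes on the component.  It cannot be [u - 1]: then the longitude
  would have constant trace 2, and a norm does not vanish at [lambda].  Hence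
  the component lies on the curve [x ^+ 2 = u + 3 + u^-1], on which the
  longitude has trace [x ^+ 4 - 5 * x ^+ 2 + 2].

  A pole of [x] is a zero or a pole of [u], and by the symmetry
  [u <-> u^-1] it is enough to look at the zeros.  Every regular function is, up
  to a power of [u], of the form [r(u) + x * s(u)].  If [x] has a pole of order
  [n] at a zero of [u], then [u] has order [2 * n] there, so that the two
  summands have orders of different parity in units of [n] and cannot cancel.
  The order of any function is thus [n] times an integer that does not depend
  on the chosen zero of [u]; therefore [n = 1] and there is at most one such
  zero ([simple_pole], [zero_unique]).

  At a pole of [x] the identity [T(g h) + T(g h^-1) = T(g) T(h)] for the traces
  of peripheral elements bounds the orders of the sum and of the product of
  [T(g h)] and [T(g h^-1)].  It shows first that one of the slopes 4 and -4 has
  integral trace, and then that [T(p alpha + q lambda)] has a pole of order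
  [|p + 4 s q|], for a sign [s] fixed by the pole of [x], and is integral if
  this number is 0 ([pole_torus]).

  So the degree of [f_(p, q)] is a sum of at most two terms
  [2 * |p + 4 s q|].  If one of them were missing, or if both had the same sign
  [s], the norm would vanish at [(-4 s, 1)]; so both signs occur, once each.
  Positive definiteness thus takes the place of constructing the two ideal
  points. *)

(** * Valuations of a function field *)

(** A discrete valuation of [K], trivial on the constants [c]; it need not be
  normalised.  The value at 0, which stands for an infinite order, is 0. *)
Record valuation (F K : fieldType) (c : {rmorphism F -> K}) (v : K -> int) :
    Prop := Valuation {
  val_eq0 : v 0 = 0;
  val_const : forall a, v (c a) = 0;
  val_mul : forall f g, f != 0 -> g != 0 -> v (f * g) = v f + v g;
  val_add : forall f g, f != 0 -> g != 0 -> f + g != 0 ->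
    Num.min (v f) (v g) <= v (f + g) }.

(** [f] has order at least [n], where 0 has infinite order. *)
Definition vge (K : fieldType) (v : K -> int) (n : int) (f : K) : Prop :=
  f <> 0 -> n <= v f.

Section Valuation.
Variables (F K : fieldType) (c : {rmorphism F -> K}) (v : K -> int).
Hypothesis vP : valuation c v.

Lemma val_nat n : v n%:R = 0.
Proof. by rewrite -(rmorph_nat c) (val_const vP). Qed.

Lemma valN f : v (- f) = v f.
Proof.
have [->|f0] := eqVneq f 0; first by rewrite oppr0.
have -> : - f = c (-1) * f by rewrite rmorphN rmorph1 mulN1r.
rewrite (val_mul vP) ?(val_const vP) ?add0r//.
by rewrite rmorphN rmorph1 oppr_eq0 oner_eq0.
Qed.

Lemma valX f n : f != 0 -> v (f ^+ n) = v f * n%:Z.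
Proof.
move=> f0; elim: n => [|n IH]; first by rewrite expr0 (val_nat 1) mulr0.
by rewrite exprS (val_mul vP) ?expf_neq0// IH; lia.
Qed.

Lemma val_add_or f g : f != 0 -> g != 0 -> f + g != 0 ->
  v f <= v (f + g) \/ v g <= v (f + g).
Proof.
by move=> f0 g0 fg0; apply/orP; rewrite -ge_min; exact: (val_add vP).
Qed.

Lemma vgeD n f g : vge v n f -> vge v n g -> vge v n (f + g).
Proof.
move=> nf ng /eqP fg0.
have [f0|f0] := eqVneq f 0; first by move: fg0; rewrite f0 !add0r => /eqP/ng.
have [g0|g0] := eqVneq g 0; first by move: fg0; rewrite g0 !addr0 => /eqP/nf.
move/eqP: (g0) => /ng; move/eqP: (f0) => /nf.
by have [|] := val_add_or f0 g0 fg0 => fg nf' ng'; apply: le_trans fg.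
Qed.

Lemma vgeN n f : vge v n f -> vge v n (- f).
Proof.
by move=> nf /eqP; rewrite oppr_eq0 => /eqP/nf; rewrite valN.
Qed.

Lemma vgeB n f g : vge v n f -> vge v n g -> vge v n (f - g).
Proof. by move=> nf /vgeN; exact: vgeD. Qed.

Lemma vgeM m n f g : vge v m f -> vge v n g -> vge v (m + n) (f * g).
Proof.
move=> mf ng /eqP; rewrite mulf_eq0 negb_or => /andP[f0 g0].
rewrite (val_mul vP)//.
by move/eqP: (f0) => /mf; move/eqP: (g0) => /ng; lia.
Qed.

Lemma vgeM0 f g : vge v 0 f -> vge v 0 g -> vge v 0 (f * g).
Proof. by move=> f0 /(vgeM f0). Qed.

Lemma vge_le m n f : m <= n -> vge v n f -> vge v m f.
Proof. by move=> mn nf /nf; lia. Qed.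

Lemma vge_nat n : vge v 0 n%:R.
Proof. by rewrite /vge val_nat. Qed.

Lemma vge_self f : vge v (v f) f.
Proof. by []. Qed.

Lemma val_dominant f g : f != 0 -> vge v (v f + 1) g ->
  f + g != 0 /\ v (f + g) = v f.
Proof.
move=> f0 gf; have fg0 : f + g != 0.
  apply/eqP => /eqP; rewrite addr_eq0 => /eqP fg.
  have /gf : g <> 0 by apply/eqP; rewrite -oppr_eq0 -fg.
  by rewrite fg valN; lia.
split=> //; apply/eqP; rewrite eq_le; apply/andP; split; last first.
  have gf' : vge v (v f) g by apply: vge_le gf; lia.
  exact: (vgeD (@vge_self f) gf' (elimN eqP fg0)).
rewrite leNgt; apply/negP => lt.
have : vge v (v f + 1) f.
  rewrite -[X in vge _ _ X](addrK g); apply: vgeB => //.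
  by apply: vge_le (@vge_self (f + g)); rewrite lezD1.
by move=> /(_ (elimN eqP f0)); lia.
Qed.

(** A Newton polygon argument for the monic quadratic polynomial with roots [f]
  and [g]. *)
Lemma vge_roots k f g : vge v k (f + g) -> vge v (2 * k) (f * g) -> vge v k f.
Proof.
move=> sP pP /eqP f0; rewrite leNgt; apply/negP => fk.
have gP : vge v (v f + 1) g.
  move=> /eqP g0; have /eqP fg0 := mulf_neq0 f0 g0.
  by move: (pP fg0); rewrite (val_mul vP) //; lia.
have [fg0 E] := val_dominant f0 gP.
by have := sP (elimN eqP fg0); rewrite E; lia.
Qed.

Lemma val_roots k f g : vge v k (f + g) -> f * g != 0 -> v (f * g) = 2 * k ->
  v f = k.
Proof.
move=> sP; rewrite mulf_eq0 negb_or => /andP[f0 g0] E.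
have pP : vge v (2 * k) (f * g) by rewrite /vge E.
have fP := vge_roots sP pP (elimN eqP f0).
move: sP pP; rewrite (addrC f) (mulrC f) => sP pP.
have gP := vge_roots sP pP (elimN eqP g0).
by move: E; rewrite (val_mul vP) //; lia.
Qed.

(** Here the roots have different orders, namely 0 and [k]. *)
Lemma val_roots_split k f g : k < 0 -> f + g != 0 -> v (f + g) = k ->
  f * g != 0 -> v (f * g) = k -> v f = 0 \/ v g = 0.
Proof.
move=> k0 s0 sk; rewrite mulf_eq0 negb_or => /andP[f0 g0].
rewrite (val_mul vP)// => pk.
have := val_add_or f0 g0 s0; rewrite sk => mP.
have [fg|fg|fg] := ltgtP (v f) (v g); last by lia.
- have /(val_dominant f0)[_] : vge v (v f + 1) g by move=> _; lia.
  by rewrite sk; lia.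
- have /(val_dominant g0)[_] : vge v (v g + 1) f by move=> _; lia.
  by rewrite addrC sk; lia.
Qed.

(** The order of the pole of [f], 0 if there is none. *)
Definition pole (f : K) : int := Num.max (- v f) 0.

Lemma pole_vge0 f : vge v 0 f -> pole f = 0.
Proof.
rewrite /pole => fP; apply/max_r; have [->|/eqP f0] := eqVneq f 0.
  by rewrite (val_eq0 vP).
by move: (fP f0); lia.
Qed.

Lemma pole_neg f : v f <= 0 -> pole f = - v f.
Proof. by move=> f0; apply/max_l; lia. Qed.

Lemma pole_sqr_sub4 f : pole (f ^+ 2 - 4) = 2 * pole f.
Proof.
have int0 : vge v 0 f -> pole (f ^+ 2 - 4) = 2 * pole f.
  move=> fP; rewrite (pole_vge0 fP) mulr0; apply: pole_vge0.
  apply: vgeB; last exact: (@vge_nat 4).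
  by rewrite expr2; apply: vgeM0.
have [f0|f0] := eqVneq f 0; first by apply: int0 => /(_ f0).
have [fv|fv] := leP 0 (v f); first by apply: int0.
have [] := @val_dominant (f ^+ 2) (- 4) (expf_neq0 _ f0).
  by rewrite valX//; apply: vgeN; apply: vge_le (@vge_nat 4); lia.
by rewrite valX// => _ E; rewrite !pole_neg ?E; lia.
Qed.

(** * Orders of the traces on a peripheral torus *)

(** [T p q] stands for the trace of [p alpha + q lambda]. *)
Section Torus.
Variable T : int -> int -> K.
Hypothesis T00 : T 0 0 = 2.
Hypothesis TD : forall p q p' q',
  T (p + p') (q + q') + T (p - p') (q - q') = T p q * T p' q'.

Lemma torusN p q : T (- p) (- q) = T p q.
Proof.
apply: (@addrI _ (T p q)).
by have := TD 0 0 p q; rewrite !add0r T00 => ->; ring.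
Qed.

Lemma torusM p q p' q' :
  T (p + p') (q + q') * T (p - p') (q - q') =
  T p q ^+ 2 + T p' q' ^+ 2 - 4.
Proof.
have sq a b : T (a + a) (b + b) = T a b ^+ 2 - 2.
  by rewrite expr2 -TD !subrr T00; ring.
rewrite -TD.
have -> : p + p' + (p - p') = p + p by ring.
have -> : q + q' + (q - q') = q + q by ring.
have -> : p + p' - (p - p') = p' + p' by ring.
have -> : q + q' - (q - q') = q' + q' by ring.
by rewrite !sq; ring.
Qed.

Lemma vge_torus_mul a b : vge v 0 (T a b) ->
  forall k : int, vge v 0 (T (k * a) (k * b)).
Proof.
move=> ab.
have H (n : nat) : vge v 0 (T (n%:Z * a) (n%:Z * b)) /\
                   vge v 0 (T (n.+1%:Z * a) (n.+1%:Z * b)).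
  elim: n => [|n [IH1 IH2]].
    by rewrite !mul0r T00 !mul1r; split=> //; exact: (@vge_nat 2).
  split=> //.
  have := TD (n.+1%:Z * a) (n.+1%:Z * b) a b.
  have -> : n.+1%:Z * a + a = n.+2%:Z * a by lia.
  have -> : n.+1%:Z * b + b = n.+2%:Z * b by lia.
  have -> : n.+1%:Z * a - a = n%:Z * a by lia.
  have -> : n.+1%:Z * b - b = n%:Z * b by lia.
  move=> /(canRL (addrK _)) ->; apply: vgeB => //.
  by apply: vgeM0.
case=> n; first by case: (H n).
rewrite -torusN NegzE !mulNr !opprK; by case: (H n.+1).
Qed.

Lemma val_torus_mul a b : T a b != 0 -> v (T a b) < 0 ->
  forall n : nat, (0 < n)%N ->
  T (n%:Z * a) (n%:Z * b) != 0 /\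
  v (T (n%:Z * a) (n%:Z * b)) = n%:Z * v (T a b).
Proof.
move=> ab0 abv.
have H (n : nat) : vge v (n%:Z * v (T a b)) (T (n%:Z * a) (n%:Z * b)) /\
    (T (n.+1%:Z * a) (n.+1%:Z * b) != 0 /\
     v (T (n.+1%:Z * a) (n.+1%:Z * b)) = n.+1%:Z * v (T a b)).
  elim: n => [|n [IH1 [IH2 IH3]]].
    by rewrite !mul0r T00 !mul1r; split=> //; exact: (@vge_nat 2).
  split; first by rewrite /vge IH3.
  have := TD (n.+1%:Z * a) (n.+1%:Z * b) a b.
  have -> : n.+1%:Z * a + a = n.+2%:Z * a by lia.
  have -> : n.+1%:Z * b + b = n.+2%:Z * b by lia.
  have -> : n.+1%:Z * a - a = n%:Z * a by lia.
  have -> : n.+1%:Z * b - b = n%:Z * b by lia.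
  move=> /(canRL (addrK _)) ->.
  have E : v (T (n.+1%:Z * a) (n.+1%:Z * b) * T a b) = n.+2%:Z * v (T a b).
    by rewrite (val_mul vP)// IH3; lia.
  rewrite -E; apply: val_dominant; first exact: mulf_neq0.
  by rewrite E; apply: vgeN; apply: vge_le IH1; lia.
case=> // n _; by case: (H n).
Qed.

(** If the trace has a pole at [w = (a, b)] and is integral at [u = (a', b')],
  then its order at [k w + j u] is that at [k w]. *)
Lemma val_torus_slope a b a' b' :
    T a b != 0 -> v (T a b) < 0 -> vge v 0 (T a' b') ->
  forall k j : int, k != 0 ->
    T (k * a + j * a') (k * b + j * b') != 0 /\
    v (T (k * a + j * a') (k * b + j * b')) = `|k| * v (T a b).
Proof.
move=> ab0 abv uP.
have H (n : nat) (j : int) : (0 < n)%N ->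
    T (n%:Z * a + j * a') (n%:Z * b + j * b') != 0 /\
    v (T (n%:Z * a + j * a') (n%:Z * b + j * b')) = n%:Z * v (T a b).
  move=> n0; have [n1 n2] := val_torus_mul ab0 abv n0.
  have jP := @vge_torus_mul _ _ uP j.
  have sP : vge v (n%:Z * v (T a b))
     (T (n%:Z * a + j * a') (n%:Z * b + j * b') +
      T (n%:Z * a - j * a') (n%:Z * b - j * b')).
    rewrite TD -[X in vge _ X]addr0; apply: vgeM => //.
    by rewrite /vge n2.
  have sqv : v (T (n%:Z * a) (n%:Z * b) ^+ 2) = 2 * (n%:Z * v (T a b)).
    by rewrite valX// n2; lia.
  have [|p0 pv] := @val_dominant (T (n%:Z * a) (n%:Z * b) ^+ 2)
      (T (j * a') (j * b') ^+ 2 - 4) (expf_neq0 _ n1).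
    have i0 : vge v 0 (T (j * a') (j * b') ^+ 2 - 4).
      apply: vgeB; last exact: (@vge_nat 4).
      by rewrite expr2; apply: vgeM0.
    by rewrite sqv; apply: vge_le i0; nia.
  rewrite addrA -torusM in p0 pv.
  rewrite sqv in pv.
  split; last exact: val_roots sP p0 pv.
  by move: p0; rewrite mulf_eq0 negb_or => /andP[].
move=> [n|n] j k0.
  by have -> : `|Posz n| = n%:Z; [lia|apply: H; lia].
have -> : `|Negz n| = n.+1%:Z by lia.
rewrite -torusN NegzE.
have -> : - (- n.+1%:Z * a + j * a') = n.+1%:Z * a + - j * a' by ring.
have -> : - (- n.+1%:Z * b + j * b') = n.+1%:Z * b + - j * b' by ring.
exact: H.
Qed.

Hypothesis two_neq0 : 2 != 0 :> K.
Hypothesis T01 : T 0 1 = T 1 0 ^+ 4 - 5 * T 1 0 ^+ 2 + 2.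

Lemma vge_torus : vge v 0 (T 1 0) -> forall p q, vge v 0 (T p q).
Proof.
move=> xP p q.
have X n : vge v 0 (T 1 0 ^+ n).
  elim: n => [|n IH]; first exact: (@vge_nat 1).
  by rewrite exprS; apply: vgeM0.
have lP : vge v 0 (T 0 1).
  rewrite T01; apply: vgeD; last exact: (@vge_nat 2).
  apply: vgeB => //; apply: vgeM0 => //.
  exact: (@vge_nat 5).
have pP := @vge_torus_mul _ _ xP p; have qP := @vge_torus_mul _ _ lP q.
rewrite mulr1 mulr0 in pP qP; rewrite mulr1 mulr0 in qP.
have := TD p 0 0 q; have := torusM p 0 0 q.
rewrite !addr0 !add0r ?subr0 => pE sE.
apply: (@vge_roots 0 _ (T p (- q))).
  by rewrite sE; apply: vgeM0.
rewrite pE mulr0; apply: vgeB; last exact: (@vge_nat 4).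
by apply: vgeD; rewrite expr2; apply: vgeM0.
Qed.

(** The traces at [4 alpha + lambda] and [4 alpha - lambda] have a sum and a
  product of the same order, so one of them is integral. *)
Lemma torus_boundary_slope : v (T 1 0) < 0 ->
  exists2 s : int, s = 1 \/ s = -1 & vge v 0 (T 4 (- s)).
Proof.
move=> xv; have x0 : T 1 0 != 0.
  by apply: contraTN xv => /eqP ->; rewrite (val_eq0 vP).
have [m40 m4v] := val_torus_mul x0 xv (isT : (0 < 4)%N).
rewrite mulr1 mulr0 in m40 m4v.
have [l0 lv] : T 0 1 != 0 /\ v (T 0 1) = 4 * v (T 1 0).
  have [] := @val_dominant (T 1 0 ^+ 4) (- (5 * T 1 0 ^+ 2) + 2)
    (expf_neq0 _ x0).
    apply: vgeD; last by apply: vge_le (@vge_nat 2); rewrite valX//; lia.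
    apply: vgeN; have := vgeM (@vge_nat 5) (@vge_self (T 1 0 ^+ 2)).
    by apply: vge_le; rewrite !valX//; lia.
  by rewrite addrA -T01 valX// => -> ->; split=> //; lia.
have sE : T 4 1 + T 4 (-1) = T 4 0 * T 0 1.
  by have := TD 4 0 0 1; rewrite !addr0 add0r ?subr0 ?sub0r.
have pE : T 4 1 * T 4 (-1) = T 4 0 ^+ 2 + T 0 1 ^+ 2 - 4.
  by have := torusM 4 0 0 1; rewrite !addr0 add0r ?subr0 ?sub0r.
(* both squares are monic of degree 8 in the trace of the meridian, so their
   leading terms add up instead of cancelling *)
have [p0 pv] : T 4 1 * T 4 (-1) != 0 /\
    v (T 4 1 * T 4 (-1)) = 8 * v (T 1 0).
  have dbl a b : T (a + a) (b + b) = T a b ^+ 2 - 2.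
    by rewrite expr2 -TD !subrr T00; ring.
  have e4 : T 4 0 = (T 1 0 ^+ 2 - 2) ^+ 2 - 2 by rewrite (dbl 2 0) (dbl 1 0).
  have mono m n : (n <= 6)%N -> vge v (6 * v (T 1 0)) (m%:R * T 1 0 ^+ n).
    move=> n6; have := vgeM (@vge_nat m) (@vge_self (T 1 0 ^+ n)).
    by apply: vge_le; rewrite valX//; nia.
  have lead : v (2 * T 1 0 ^+ 8) = 8 * v (T 1 0).
    by rewrite (val_mul vP) ?expf_neq0// valX// (val_nat 2); lia.
  have [] := @val_dominant (2 * T 1 0 ^+ 8) (- (18 * T 1 0 ^+ 6) +
    49 * T 1 0 ^+ 4 - 36 * T 1 0 ^+ 2 + 4 * T 1 0 ^+ 0).
  - by rewrite mulf_neq0 ?expf_neq0.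
  - rewrite lead; apply: (@vge_le _ (6 * v (T 1 0))); first by lia.
    apply: vgeD; last exact: mono.
    apply: vgeB; last exact: mono.
    by apply: vgeD; [apply: vgeN|]; exact: mono.
  rewrite lead pE e4 T01.
  by have -> : forall x : K, 2 * x ^+ 8 + (- (18 * x ^+ 6) + 49 * x ^+ 4 -
      36 * x ^+ 2 + 4 * x ^+ 0) = ((x ^+ 2 - 2) ^+ 2 - 2) ^+ 2 +
      (x ^+ 4 - 5 * x ^+ 2 + 2) ^+ 2 - 4 by move=> x; ring.
have [|||||s1|s1] := @val_roots_split (8 * v (T 1 0)) (T 4 1) (T 4 (-1)).
- by lia.
- by rewrite sE mulf_neq0.
- by rewrite sE (val_mul vP)// m4v lv; lia.
- exact: p0.
- by rewrite pv.
- by exists (-1); [right|rewrite opprK /vge s1].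
- by exists 1; [left|rewrite /vge s1].
Qed.

Lemma pole_torus : exists2 s : int, s = 1 \/ s = -1 &
  forall p q, pole (T p q) = pole (T 1 0) * `|p + 4 * s * q|.
Proof.
have [xv|xv] := boolP (0 <= v (T 1 0)).
  exists 1 => [|p q]; first by left.
  have xP : vge v 0 (T 1 0) by [].
  by rewrite !pole_vge0 ?mul0r//; exact: vge_torus.
have {}xv : v (T 1 0) < 0 by lia.
have x0 : T 1 0 != 0.
  by apply: contraTN xv => /eqP ->; rewrite (val_eq0 vP).
have [s sE uP] := torus_boundary_slope xv; exists s => // p q.
(* p alpha + q lambda = (p + 4 s q) alpha - s q (4 alpha - s lambda) *)
have [k0|k0] := eqVneq (p + 4 * s * q) 0.
  rewrite k0 normr0 mulr0; apply: pole_vge0.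
  have := @vge_torus_mul _ _ uP (- s * q).
  have -> : - s * q * 4 = p by lia.
  by have -> : - s * q * - s = q by case: sE => ->; ring.
have [_] := val_torus_slope x0 xv uP (- s * q) k0.
have -> : (p + 4 * s * q) * 1 + - s * q * 4 = p by ring.
have -> : (p + 4 * s * q) * 0 + - s * q * - s = q.
  by case: sE => ->; ring.
move=> E; rewrite (@pole_neg (T p q)) ?E; last by nia.
by rewrite pole_neg; lia.
Qed.

End Torus.
End Valuation.

(** * Places of the curve x^2 = u + 3 + 1/u *)

(** The [F]-subalgebra generated by [x], [u] and the inverse of [u]. *)
Inductive generated (F K : fieldType) (c : {rmorphism F -> K}) (x u : K) :
    K -> Prop :=
| generated_const a : generated c x u (c a)
| generated_x : generated c x u x
| generated_u : generated c x u u
| generated_inv : generated c x u u^-1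
| generated_add f g : generated c x u f -> generated c x u g ->
    generated c x u (f + g)
| generated_mul f g : generated c x u f -> generated c x u g ->
    generated c x u (f * g).

Lemma generated_symm (F K : fieldType) (c : {rmorphism F -> K}) (x u f : K) :
  generated c x u f -> generated c x u^-1 f.
Proof.
elim=> [a|||| f1 g1 _ IHf _ IHg|f1 g1 _ IHf _ IHg]; try by constructor.
by rewrite -{2}(invrK u); constructor.
Qed.

Section Curve.
Variables (F K : fieldType) (c : {rmorphism F -> K}) (x u : K).
Hypothesis u_neq0 : u != 0.
Hypothesis curve : x ^+ 2 = u + 3 + u^-1.

Local Notation ev p := (map_poly c p).[u].

Let evC a : ev a%:P = c a.
Proof. by rewrite map_polyC hornerC. Qed.
Let evX : ev 'X = u.
Proof. by rewrite map_polyX hornerX. Qed.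
Let evD p q : ev (p + q) = ev p + ev q.
Proof. by rewrite rmorphD hornerD. Qed.
Let evM p q : ev (p * q) = ev p * ev q.
Proof. by rewrite rmorphM hornerM. Qed.
Let ev0 : ev 0 = 0. Proof. by rewrite rmorph0 horner0. Qed.
Let ev_nat n : ev n%:R = n%:R.
Proof. by rewrite rmorph_nat -polyC_natr hornerC. Qed.
Let ev1 : ev 1 = 1. Proof. exact: (ev_nat 1). Qed.
Let evXn n : ev ('X^n) = u ^+ n.
Proof. by rewrite map_polyXn hornerXn. Qed.

Lemma generated_normal_form f : generated c x u f ->
  exists (k : nat) (r s : {poly F}), f * u ^+ k = ev r + x * ev s.
Proof.
elim=> [a||||f1 g1 _ [k [r [s E]]] _ [k' [r' [s' E']]]
            |f1 g1 _ [k [r [s E]]] _ [k' [r' [s' E']]]].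
- by exists 0%N, a%:P, 0; rewrite evC ev0; ring.
- by exists 0%N, 0, 1; rewrite ev0 ev1; ring.
- by exists 0%N, 'X, 0; rewrite evX ev0; ring.
- by exists 1%N, 1, 0; rewrite ev0 ev1 expr1 mulVf// mulr0 addr0.
- exists (k + k')%N, ('X^k' * r + 'X^k * r'), ('X^k' * s + 'X^k * s').
  rewrite !(evD, evM, evXn) exprD.
  transitivity (f1 * u ^+ k * u ^+ k' + g1 * u ^+ k' * u ^+ k); first by ring.
  by rewrite E E'; ring.
- exists (k + k' + 1)%N,
    ('X * (r * r') + ('X^2 + 3 * 'X + 1) * (s * s')),
    ('X * (r * s' + s * r')).
  rewrite !(evD, evM, evXn, evX, ev1, ev_nat) !exprD expr1.
  transitivity ((f1 * u ^+ k) * (g1 * u ^+ k') * u); first by ring.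
  have -> : u ^+ 2 + 3 * u + 1 = u * x ^+ 2.
    by rewrite curve !mulrDr mulfV//; ring.
  by rewrite E E'; ring.
Qed.

Lemma val_x v : valuation c v -> 0 < v u -> v u = -2 * v x.
Proof.
move=> vP vu.
have [] := @val_dominant _ _ _ _ vP 1 (u ^+ 2 + 3 * u) (oner_neq0 _).
  rewrite (val_nat vP 1).
  apply: (vgeD vP); first by rewrite /vge (valX vP)//; lia.
  apply: (@vge_le _ _ _ (0 + v u)); first by lia.
  by apply: (vgeM vP) => //; exact: (@vge_nat _ _ _ _ vP 3).
have -> : 1 + (u ^+ 2 + 3 * u) = u * x ^+ 2.
  by rewrite curve !mulrDr mulfV//; ring.
rewrite mulf_eq0 negb_or sqrf_eq0 => /andP[_ x0].
rewrite (val_nat vP 1) (val_mul vP) ?sqrf_eq0// (valX vP)//; lia.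
Qed.

(** At a zero of [u] the order of a polynomial in [u] depends on [v] only
  through the order of [u]. *)
Lemma poly_order (p : {poly F}) : exists e : nat, forall v, valuation c v ->
  0 < v u -> ev p != 0 -> v (ev p) = e%:Z * v u.
Proof.
elim/poly_ind: p => [|p a [e IH]].
  by exists 0%N => v vP vu; rewrite ev0 eqxx.
have evE : ev (p * 'X + a%:P) = ev p * u + c a.
  by rewrite evD evM evX evC.
have [->|a0] := eqVneq a 0.
  exists e.+1 => v vP vu.
  rewrite polyC0 addr0 evM evX.
  rewrite mulf_eq0 negb_or => /andP[p0 _].
  by rewrite (val_mul vP)// (IH _ vP vu p0); lia.
exists 0%N => v vP vu _; rewrite evE addrC mul0r.
have ca0 : c a != 0 by rewrite fmorph_eq0.
rewrite -(val_const vP a).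
case: (@val_dominant _ _ _ _ vP (c a) (ev p * u) ca0) => //.
rewrite (val_const vP) => /eqP; rewrite mulf_eq0 negb_or => /andP[p0 _].
by rewrite (val_mul vP)// (IH _ vP vu p0); nia.
Qed.

(** At a zero of [u] the order of [ev r] is an even multiple of that of [x],
  the order of [x * ev s] an odd one, so that they cannot cancel. *)
Lemma generated_order f : generated c x u f ->
  exists e : int, forall v, valuation c v -> 0 < v u -> f != 0 ->
    v f = e * v x.
Proof.
move=> /generated_normal_form[k [r [s E]]].
have [d rP] := poly_order r; have [e sP] := poly_order s.
have key v e' : valuation c v -> 0 < v u -> f != 0 ->
    v (f * u ^+ k) = e' * v x -> v f = (e' + 2 * k%:Z) * v x.
  move=> vP vu f0; rewrite (val_mul vP) ?expf_neq0// (valX vP)//.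
  by rewrite (val_x vP vu); lia.
have x0 v : valuation c v -> 0 < v u -> x != 0.
  move=> vP vu; apply: contraTneq vu => x0.
  rewrite -leNgt; apply: contraT; rewrite -ltNge => vu.
  by move: (vu); rewrite (val_x vP vu) x0 (val_eq0 vP).
have vr v : valuation c v -> 0 < v u -> ev r != 0 ->
    v (ev r) = - 2 * d%:Z * v x.
  by move=> vP vu r0; rewrite (rP v)// (val_x vP vu); ring.
have vs v : valuation c v -> 0 < v u -> ev s != 0 ->
    x * ev s != 0 /\ v (x * ev s) = (1 - 2 * e%:Z) * v x.
  move=> vP vu s0; have x0' := x0 v vP vu; split; first exact: mulf_neq0.
  by rewrite (val_mul vP)// (sP v)// (val_x vP vu); ring.
have [r0|r0] := eqVneq (ev r) 0.
  exists (1 - 2 * e%:Z + 2 * k%:Z) => v vP vu f0; apply: key => //.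
  have : f * u ^+ k != 0 by rewrite mulf_neq0 ?expf_neq0.
  rewrite E r0 add0r; rewrite mulf_eq0 negb_or => /andP[_ s0].
  by have [] := vs v vP vu s0.
have [s0|s0] := eqVneq (ev s) 0.
  exists (- 2 * d%:Z + 2 * k%:Z) => v vP vu f0; apply: key => //.
  by rewrite E s0 mulr0 addr0 vr.
have [le|le] := ltP (- 2 * d%:Z) (1 - 2 * e%:Z).
  exists (1 - 2 * e%:Z + 2 * k%:Z) => v vP vu f0; apply: key => //.
  have [xs0 xsv] := vs v vP vu s0; have := val_x vP vu => vx.
  rewrite E addrC -xsv.
  suff H : vge v (v (x * ev s) + 1) (ev r) by have [] := val_dominant vP xs0 H.
  by rewrite /vge vr// xsv; nia.
exists (- 2 * d%:Z + 2 * k%:Z) => v vP vu f0; apply: key => //.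
have [xs0 xsv] := vs v vP vu s0; have := val_x vP vu => vx.
rewrite E -vr//.
suff H : vge v (v (ev r) + 1) (x * ev s) by have [] := val_dominant vP r0 H.
by rewrite /vge vr// xsv; nia.
Qed.

Hypothesis fractions : forall f : K, exists g h,
  [/\ generated c x u g, generated c x u h, h != 0 & f = g / h].

Lemma fraction_order f : exists e : int, forall v, valuation c v ->
  0 < v u -> f != 0 -> v f = e * v x.
Proof.
have [g [h [/generated_order[e gP] /generated_order[d hP] h0 ->]]] :=
  fractions f.
exists (e - d) => v vP vu; rewrite mulf_eq0 negb_or => /andP[g0 hi0].
rewrite mulrBl -gP// -hP//.
have <- : v (g / h) + v h = v g by rewrite -(val_mul vP) ?divfK// mulf_neq0.
by rewrite addrK.
Qed.

(** The value 1 at some [t] makes the valuation normalised. *)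
Lemma simple_pole v t : valuation c v -> 0 < v u -> v t = 1 -> v x = -1.
Proof.
move=> vP vu vt; have [e tP] := fraction_order t.
have t0 : t != 0 by apply: contra_eq_neq vt => ->; rewrite (val_eq0 vP).
have ex := tP _ vP vu t0; rewrite vt in ex; have ux := val_x vP vu.
have x_lt0 : v x < 0 by lia.
have e_lt0 : e < 0 by nia.
by nia.
Qed.

Lemma zero_unique v w t t' : valuation c v -> 0 < v u -> v t = 1 ->
  valuation c w -> 0 < w u -> w t' = 1 -> v =1 w.
Proof.
move=> vP vu vt wP wu wt f; have [e fP] := fraction_order f.
have [->|f0] := eqVneq f 0; first by rewrite (val_eq0 vP) (val_eq0 wP).
by rewrite (fP v)// (fP w)// (simple_pole vP vu vt) (simple_pole wP wu wt).
Qed.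

End Curve.

(** * The figure-eight knot group *)

Section Group.
Local Open Scope group_scope.

(** The generator [beta]. *)
Definition second_meridian : fig8_group := of_word [:: (true, false)].

Lemma of_word_catg u v : of_word (u ++ v) = of_word u * of_word v.
Proof. by rewrite -of_word_cat. Qed.

Lemma of_word_letter g :
  of_word [:: (g, true)] = (of_word [:: (g, false)])^-1.
Proof.
apply/esym/mulg1_eq; rewrite -of_word_catg; apply/of_wordP.
exact: (word_equiv_cancel g false).
Qed.

(** The generator, or its inverse, denoted by a letter. *)
Definition of_letter (l : bool * bool) : fig8_group :=
  let g := if l.1 then second_meridian else meridian in
  if l.2 then g^-1 else g.

Lemma of_word_cons l w : of_word (l :: w) = of_letter l * of_word w.
Proof.
rewrite -cat1s of_word_catg; congr (_ * _).
by case: l => [] [] []; rewrite /of_letter ?of_word_letter.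
Qed.

Lemma of_word_nil : of_word [::] = 1.
Proof. by []. Qed.

(** The relator is conjugate both to [c a c^-1 b^-1] and to
  [d a d^-1 b^-1]. *)
Lemma relator_conjugations (G : groupType) (a b : G) :
  b^-1 * a^-1 * b * a * b^-1 * a * b * a^-1 * b^-1 * a = 1 ->
  let c := a * b^-1 * a^-1 * b in let d := a^-1 * b * a * b^-1 in
  c * a = b * c /\ d * a = b * d.
Proof.
move=> R c d; split; apply/divg1_eq.
  transitivity (a * 1 * a^-1); last by rewrite mulg1 mulgV.
  by rewrite -R /c !(invgM, invgK, mulgA) mulgK.
transitivity (b * 1 * b^-1); last by rewrite mulg1 mulgV.
by rewrite -R /d !(invgM, invgK, mulgA) mulgV mul1g.
Qed.

Lemma fig8_relation :
  let a := meridian in let b := second_meridian in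
  b^-1 * a^-1 * b * a * b^-1 * a * b * a^-1 * b^-1 * a = 1.
Proof.
have : of_word fig8_relator = of_word [::] by apply/of_wordP; constructor.
by rewrite !of_word_cons of_word_nil !mulgA mulg1.
Qed.

(** An element that conjugates [alpha] to [beta]. *)
Definition conjugator : fig8_group :=
  meridian * second_meridian^-1 * meridian^-1 * second_meridian.

Lemma meridians_conjugate :
  conjugator * meridian = second_meridian * conjugator.
Proof. by have [] := relator_conjugations fig8_relation. Qed.

Lemma commute_meridian_longitude : commute meridian longitude.
Proof.
have [] := relator_conjugations fig8_relation.
(* lambda = c^-1 d, where both c and d conjugate alpha to beta *)
set a := meridian; set b := second_meridian; set c := _ * b; set d := _ * b^-1.
move=> ca da; have -> : longitude = c^-1 * d.
  rewrite /longitude !of_word_cons of_word_nil /of_letter /= /c /d.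
  by rewrite !(invgM, invgK, mulgA, mulg1).
by apply: (mulgI c); rewrite !mulgA ca mulgK mulgV mul1g da /d !mulgA.
Qed.

Lemma commute_zexpg g h m n :
  commute g h -> commute (zexpg g m) (zexpg h n).
Proof.
move=> gh; case: m n => [m|m] [n|n] /=; rewrite -?expVgn;
  apply: commuteX2 => //.
- exact: commuteV.
- by apply/commute_sym/commuteV/commute_sym.
- by apply/commuteV/commute_sym/commuteV/commute_sym.
Qed.

Lemma zexpgB g (m n : nat) : zexpg g (m%:Z - n%:Z)%R = g ^+ m * g ^- n.
Proof.
have cV i j : commute (g ^+ i) (g ^- j).
  by apply: commuteV; apply: commuteX2; exact: commute_refl.
have [nm|mn] := leqP n m.
  by rewrite subzn//= -{2}(subnK nm) expgnDr mulgK.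
have -> : (m%:Z - n%:Z = - (n - m)%N%:Z)%R by lia.
case E : (n - m)%N => [|k]; first by lia.
rewrite -NegzE /= -E.
by rewrite -{2}(subnKC (ltnW mn)) expgnDr invgM mulgA cV mulgK.
Qed.

Lemma zexpgD g (m n : int) : zexpg g (m + n)%R = zexpg g m * zexpg g n.
Proof.
have B (m' : int) : exists i j : nat, m' = (i%:Z - j%:Z)%R.
  case: m' => k; first by exists k, 0%N; lia.
  by exists 0%N, k.+1; lia.
have [i [j ->]] := B m; have [k [l ->]] := B n.
have -> : (i%:Z - j%:Z + (k%:Z - l%:Z) = (i + k)%N%:Z - (l + j)%N%:Z)%R by lia.
have cV i' j' : commute (g ^+ i') (g ^- j').
  by apply: commuteV; apply: commuteX2; exact: commute_refl.
rewrite !zexpgB !expgnDr invgM !mulgA; congr (_ * _).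
by rewrite -!mulgA (cV k j).
Qed.

Lemma peripheralD p q p' q' :
  peripheral (p + p')%R (q + q')%R = peripheral p q * peripheral p' q'.
Proof.
rewrite /peripheral !zexpgD -!mulgA; congr (_ * _); rewrite !mulgA.
by congr (_ * _); apply/commute_zexpg/commute_meridian_longitude.
Qed.

Lemma peripheral0 : peripheral 0%R 0%R = 1.
Proof. by rewrite /peripheral /= !expg0 mulg1. Qed.

Lemma peripheralB p q p' q' :
  peripheral (p - p')%R (q - q')%R = peripheral p q * (peripheral p' q')^-1.
Proof.
apply: (mulIg (peripheral p' q')); rewrite mulgVK -peripheralD.
by congr peripheral; ring.
Qed.

Lemma peripheral_meridian : peripheral 1%R 0%R = meridian.
Proof. by rewrite /peripheral /= expg0 mulg1. Qed.

Lemma peripheral_longitude : peripheral 0%R 1%R = longitude.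
Proof. by rewrite /peripheral /= expg0 mul1g. Qed.

End Group.

(** * Trace identities in SL_2 *)

Section Traces.
Variable S : comNzRingType.
Implicit Types A B : 'M[S]_2.

Lemma mxtrace2 A : \tr A = A 0 0 + A 1 1.
Proof.
rewrite /mxtrace big_ord_recr big_ord1 /=.
by congr (A _ _ + A _ _); apply: val_inj.
Qed.

Lemma mulmx2 A B i j : (A *m B) i j = A i 0 * B 0 j + A i 1 * B 1 j.
Proof.
rewrite mxE big_ord_recr big_ord1 /=.
by congr (A _ _ * B _ _ + A _ _ * B _ _); apply: val_inj.
Qed.

Lemma ord2P (i : 'I_2) : i = 0 \/ i = 1.
Proof. by case: i => [[|[|]]]// ?; [left|right]; exact: val_inj. Qed.

Lemma det_mx2 A : \det A = A 0 0 * A 1 1 - A 0 1 * A 1 0.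
Proof.
have l0 : lift 0 0 = 1 :> 'I_2 by exact: val_inj.
have l1 : lift 1 0 = 0 :> 'I_2 by exact: val_inj.
rewrite (expand_det_row _ 0) big_ord_recr big_ord1 /= /cofactor !det_mx11 !mxE.
have -> : widen_ord (leqnSn 1) 0 = 0 :> 'I_2 by exact: val_inj.
have -> : ord_max = 1 :> 'I_2 by exact: val_inj.
by rewrite l0 l1 addn0 expr0 expr1; ring.
Qed.

Lemma mx2P A B : A 0 0 = B 0 0 -> A 0 1 = B 0 1 -> A 1 0 = B 1 0 ->
  A 1 1 = B 1 1 -> A = B.
Proof.
move=> h00 h01 h10 h11; apply/matrixP => i j.
by case: (ord2P i) => ->; case: (ord2P j) => ->.
Qed.

Lemma Cayley_Hamilton2 A : A *m A = \tr A *: A - (\det A)%:M.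
Proof.
by apply: mx2P; rewrite mulmx2 !mxE mxtrace2 det_mx2 /=; ring.
Qed.

Lemma Cayley_Hamilton2_polar A B :
  A *m B + B *m A =
  \tr A *: B + \tr B *: A + (\tr (A *m B) - \tr A * \tr B)%:M.
Proof.
have addE (C D : 'M[S]_2) i j : (C + D) i j = C i j + D i j by rewrite mxE.
by apply: mx2P; rewrite !addE !mulmx2 !mxE !mxtrace2 !mulmx2 /=; ring.
Qed.

Lemma adjugate2 A A' : \det A = 1 -> A' *m A = 1%:M -> A' = (\tr A)%:M - A.
Proof.
move=> dA A'A; have AK : A *m ((\tr A)%:M - A) = 1%:M.
  rewrite mulmxBr Cayley_Hamilton2 dA mul_mx_scalar.
  by apply/matrixP => i j; rewrite !mxE; ring.
by rewrite -[LHS]mulmx1 -AK mulmxA A'A mul1mx.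
Qed.

End Traces.

Section Words.
Variable S : comNzRingType.

(** The coefficients of a linear combination of [1], [A], [B] and [A *m B]. *)
Record coords := Coords { c1 : S; cA : S; cB : S; cAB : S }.

(** Left multiplication of a combination by [B] if [g] holds and by [A]
  otherwise, where [A] and [B] have determinant 1 and trace [x], and [y] is the
  trace of [A *m B^-1]. *)
Definition mul_gen (x y : S) (g : bool) (k : coords) : coords :=
  let: Coords p q r s := k in
  if g then Coords (- y * q - r - x * s) (x * q + s)
                   (p + x * q + x * r + (x ^+ 2 - y) * s) (- q)
  else Coords (- q) (p + x * q) (- s) (r + x * s).

(** Left multiplication by a letter; the inverse of [A] is [x - A]. *)
Definition mul_letter (x y : S) (l : bool * bool) (k : coords) : coords :=
  let: Coords p' q' r' s' := mul_gen x y l.1 k in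
  if l.2 then Coords (x * c1 k - p') (x * cA k - q') (x * cB k - r')
                     (x * cAB k - s')
  else Coords p' q' r' s'.

(** The coefficients of a word. *)
Definition word_coords (x y : S) (w : word) : coords :=
  foldr (mul_letter x y) (Coords 1 0 0 0) w.

(** The trace of a word; [x ^+ 2 - y] is the trace of [A *m B]. *)
Definition word_trace (x y : S) (w : word) : S :=
  let: Coords p q r s := word_coords x y w in
  2 * p + x * (q + r) + (x ^+ 2 - y) * s.

Variables A B : 'M[S]_2.
Let x := \tr A.
Let y := x ^+ 2 - \tr (A *m B).
Hypothesis detA : \det A = 1.
Hypothesis detB : \det B = 1.
Hypothesis trB : \tr B = x.

(** The linear combination with coefficients [k]. *)
Definition combination (k : coords) : 'M[S]_2 :=
  (c1 k)%:M + cA k *: A + cB k *: B + cAB k *: (A *m B).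

Lemma mulmx_gen g k :
  (if g then B else A) *m combination k = combination (mul_gen x y g k).
Proof.
have AA : A *m A = x *: A - 1%:M by rewrite Cayley_Hamilton2 detA.
have BB : B *m B = x *: B - 1%:M by rewrite Cayley_Hamilton2 detB trB.
have BA : B *m A = x *: A + x *: B - y%:M - A *m B.
  apply: (addrI (A *m B)); rewrite Cayley_Hamilton2_polar trB.
  by apply/matrixP => i j; rewrite !mxE /y; ring.
have AAB : A *m (A *m B) = x *: (A *m B) - B.
  by rewrite mulmxA AA mulmxBl mul1mx scalemxAl.
have BAB : B *m (A *m B) = A + (x ^+ 2 - y) *: B - x%:M.
  rewrite mulmxA BA !mulmxBl mulmxDl mul_scalar_mx -mulmxA BB.
  rewrite mulmxBr mulmx1 -!scalemxAl -scalemxAr BB.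
  move: (A *m B) => AB.
  by apply/matrixP => i j; rewrite !mxE; ring.
case: k => p q r s; rewrite /combination /=.
case: g; rewrite !mulmxDr mul_mx_scalar -!scalemxAr ?AA ?BB ?BA ?BAB ?AAB;
  move: (A *m B) => AB /=; apply/matrixP => i j; rewrite !mxE; ring.
Qed.

Lemma mulmx_gen_inv g k :
  (x%:M - if g then B else A) *m combination k =
  combination (mul_letter x y (g, true) k).
Proof.
rewrite mulmxBl mulmx_gen mul_scalar_mx /combination /mul_letter /=.
case: mul_gen => p' q' r' s'; case: k => p q r s /=.
by move: (A *m B) => AB; apply/matrixP => i j; rewrite !mxE; ring.
Qed.

Lemma mxtrace_combination k :
  \tr (combination k) =
  2 * c1 k + x * (cA k + cB k) + (x ^+ 2 - y) * cAB k.
Proof.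
rewrite /combination !mxtraceD !mxtraceZ mxtrace_scalar trB -/x /y.
by rewrite -mulr_natl; ring.
Qed.

End Words.

Lemma word_trace_morph (S S' : comNzRingType) (f : {rmorphism S -> S'}) x y w :
  f (word_trace x y w) = word_trace (f x) (f y) w.
Proof.
have key : word_coords (f x) (f y) w =
    let: Coords p q r s := word_coords x y w in Coords (f p) (f q) (f r) (f s).
  elim: w => [|[g e] w /= ->]; first by rewrite /= rmorph1 rmorph0.
  case: word_coords => p q r s; rewrite /mul_letter /mul_gen.
  by case: g; case: e => /=; congr Coords;
    rewrite ?(rmorphB, rmorphD, rmorphN, rmorphM, rmorphXn).
rewrite /word_trace key; case: word_coords => p q r s /=.
by rewrite !(rmorphB, rmorphD, rmorphN, rmorphM, rmorphXn, rmorph_nat).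
Qed.

Lemma word_trace_nil (S : comNzRingType) (x y : S) : word_trace x y [::] = 2.
Proof. by rewrite /word_trace /=; ring. Qed.

Lemma word_trace_relation (S : comNzRingType) (x u : S) :
  let c := [:: (false, false); (true, true); (false, true); (true, false)] in
  word_trace x (u + 1) c -
    word_trace x (u + 1) ((true, false) :: c ++ [:: (false, true)]) =
  (u - 1) * (u * x ^+ 2 - u ^+ 2 - 3 * u - 1).
Proof. by rewrite /word_trace /=; ring. Qed.

Lemma word_trace_longitude (S : comNzRingType) (x u : S) :
  word_trace x (u + 1) longitude_word =
  x ^+ 2 * (u - 1) ^+ 2 * (x ^+ 2 - u - 3) + 2.
Proof. by rewrite /word_trace /=; ring. Qed.

Lemma word_trace_closed (S : comNzRingType) (P : S -> Prop) x y w :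
  P 1 -> P x -> P y -> (forall f g, P f -> P g -> P (f - g)) ->
  (forall f g, P f -> P g -> P (f * g)) -> P (word_trace x y w).
Proof.
move=> P1 Px Py PB PM; have P0 : P 0 by rewrite -(subrr 1); apply: PB.
have PN f : P f -> P (- f) by move=> Pf; rewrite -sub0r; apply: PB.
have PD f g : P f -> P g -> P (f + g).
  by move=> Pf Pg; rewrite -(opprK g); apply: PB => //; apply: PN.
have PX2 : P (x ^+ 2 - y) by apply: PB => //; rewrite expr2; apply: PM.
have key : let: Coords p q r s := word_coords x y w in
    [/\ P p, P q, P r & P s].
  elim: w => [|[g e] w /=]; first by split.
  case: word_coords => p q r s [Pp Pq Pr Ps]; rewrite /mul_letter /mul_gen.
  by case: g; case: e => /=; split;
    repeat first [assumption | apply PB | apply PD | apply PN | apply PM].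
rewrite /word_trace; case: word_coords key => p q r s [Pp Pq Pr Ps].
have P2 : P 2 := PD 1 1 P1 P1.
exact: (PD _ _ (PD _ _ (PM _ _ P2 Pp) (PM _ _ Px (PD _ _ Pq Pr)))
  (PM _ _ PX2 Ps)).
Qed.

Section Representation.
Variables (S : comNzRingType) (rho : fig8_group -> 'M[S]_2).
Hypothesis rho_det : forall g, \det (rho g) = 1.
Hypothesis rho_mul : forall g h, rho (g * h)%g = rho g *m rho h.

Lemma rep1 : rho 1%g = 1%:M.
Proof.
have E : rho 1%g = rho 1%g *m rho 1%g by rewrite -rho_mul mulg1.
have := mul_mx_adj (rho 1%g); rewrite rho_det => H.
by rewrite -[LHS]mulmx1 -H mulmxA -E.
Qed.

Lemma repV g : rho g^-1%g = (\tr (rho g))%:M - rho g.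
Proof. by apply: adjugate2; rewrite // -rho_mul mulVg rep1. Qed.

Lemma trace_mul_inv g h : \tr (rho (g * h)%g) + \tr (rho (g * h^-1)%g) =
  \tr (rho g) * \tr (rho h).
Proof.
rewrite !rho_mul repV -mxtraceD -mulmxDr addrCA subrr addr0 mul_mx_scalar.
by rewrite mxtraceZ mulrC.
Qed.

Lemma trace_mulC g h : \tr (rho (g * h)%g) = \tr (rho (h * g)%g).
Proof. by rewrite !rho_mul mxtrace_mulC. Qed.

Lemma trace_second_meridian : \tr (rho second_meridian) = \tr (rho meridian).
Proof.
have <- : (conjugator * meridian * conjugator^-1 = second_meridian)%g.
  by rewrite meridians_conjugate mulgK.
by rewrite trace_mulC mulgA mulVg mul1g.
Qed.

Lemma trace_of_word w : \tr (rho (of_word w)) =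
  word_trace (\tr (rho meridian))
    (\tr (rho (meridian * second_meridian^-1)%g)) w.
Proof.
have trB := trace_second_meridian.
have -> : \tr (rho (meridian * second_meridian^-1)%g) =
    \tr (rho meridian) ^+ 2 - \tr (rho meridian *m rho second_meridian).
  apply: (addrI (\tr (rho (meridian * second_meridian)%g))).
  by rewrite trace_mul_inv trB rho_mul; ring.
suff -> : rho (of_word w) = combination (rho meridian) (rho second_meridian)
    (word_coords (\tr (rho meridian)) (\tr (rho meridian) ^+ 2 -
      \tr (rho meridian *m rho second_meridian)) w).
  rewrite mxtrace_combination// /word_trace.
  by case: word_coords.
elim: w => [|[g e] w IH].
  rewrite of_word_nil rep1 /combination /= !scale0r.
  by rewrite !addr0.
rewrite of_word_cons rho_mul IH; case: e.
  rewrite -mulmx_gen_inv//; congr (_ *m _).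
  by rewrite /of_letter; case: g; rewrite repV ?trB.
rewrite {2}/word_coords /= -/(word_coords _ _ w) /mul_letter /=.
have := mulmx_gen (rho_det meridian) (rho_det second_meridian) trB g.
move=> /(_ (word_coords _ _ w)) E.
rewrite -[of_letter _]/(if g then second_meridian else meridian).
rewrite -[if g then rho _ else _]fun_if in E.
by rewrite E; case: mul_gen.
Qed.

End Representation.

Lemma curve_of_relation (S : comNzRingType) (K : fieldType)
    (phi : {rmorphism S -> K}) (x u : S) :
  u * x ^+ 2 - u ^+ 2 - 3 * u - 1 = 0 ->
  [/\ phi u != 0, phi x ^+ 2 = phi u + 3 + (phi u)^-1 &
    phi (x ^+ 2 * (u - 1) ^+ 2 * (x ^+ 2 - u - 3) + 2) =
    phi x ^+ 4 - 5 * phi x ^+ 2 + 2].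
Proof.
move=> /(congr1 phi).
rewrite !(rmorphB, rmorphD, rmorphM, rmorphXn, rmorph_nat, rmorph0, rmorph1).
move: (phi x) (phi u) => X U E.
have U0 : U != 0.
  apply/eqP => U0; move/eqP: E; rewrite U0.
  have -> : 0 * X ^+ 2 - 0 ^+ 2 - 3 * 0 - 1 = -1 :> K by ring.
  by rewrite oppr_eq0 oner_eq0.
have XE : X ^+ 2 = U + 3 + U^-1.
  apply: (mulfI U0); apply/eqP; rewrite -subr_eq0; apply/eqP.
  by rewrite -E !mulrDr mulfV//; ring.
split=> //; have -> : X ^+ 4 = (X ^+ 2) ^+ 2 by ring.
by rewrite -!expr2 XE; field.
Qed.

(** * The coordinate ring and the function field *)

Section CoordinateRing.
Variables (R : realType) (X : subvariety R).
Local Notation C := R[i].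
Local Notation CX := (coordinate_ring X).
Local Notation I := (I_ X).

Lemma coordinate_ext (f g : CX) : (forall p, f p = g p) -> f = g.
Proof. by move=> fg; apply: val_inj; apply/funext. Qed.

Lemma point_representation (p : set_type X) :
  exists2 rho : fig8_group -> 'M[C]_2, SL2_representation rho &
    forall g, I g p = \tr (rho g).
Proof.
have [[S _ XE] _ _] := points_irreducible X.
case: p => chi chiX; have [sub _] := (seteqP _ _).1 XE.
have [[rho rhoP chiE] _] := sub _ (set_mem chiX).
by exists rho => // g; rewrite /= chiE.
Qed.

(** Evaluation of a regular function at the point [p]. *)
Definition evaluation (p : set_type X) (f : CX) : C := f p.

Lemma evaluation_zmod p : zmod_morphism (evaluation p).
Proof. by []. Qed.

Lemma evaluation_monoid p : monoid_morphism (evaluation p).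
Proof. by []. Qed.

HB.instance Definition _ p :=
  GRing.isZmodMorphism.Build CX C (evaluation p) (evaluation_zmod p).
HB.instance Definition _ p :=
  GRing.isMonoidMorphism.Build CX C (evaluation p) (evaluation_monoid p).

Lemma I_mul_inv g h : I (g * h)%g + I (g * h^-1)%g = I g * I h.
Proof.
apply: coordinate_ext => p; have [rho [rdet rmul] E] := point_representation p.
transitivity (I (g * h)%g p + I (g * h^-1)%g p) => //.
by rewrite !E trace_mul_inv// -!E.
Qed.

Lemma I_of_word w : I (of_word w) =
  word_trace (I meridian) (I (meridian * second_meridian^-1)%g) w.
Proof.
apply: coordinate_ext => p; have [rho [rdet rmul] E] := point_representation p.
rewrite [RHS](word_trace_morph (evaluation p)) E trace_of_word//.
by rewrite -!E.
Qed.

Lemma I1 : I 1%g = 2.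
Proof. by rewrite -of_word_nil I_of_word word_trace_nil. Qed.

Local Notation x := (I meridian).
(** The coordinate [u]; the shift by 1 makes the curve symmetric under
  [u <-> u^-1]. *)
Definition u_fun : CX := I (meridian * second_meridian^-1)%g - 1.
Local Notation u := u_fun.

(** The traces of two words for the same element are compared: the conjugator
  [c] is also [b * c * a^-1]. *)
Lemma character_relation : (u - 1) * (u * x ^+ 2 - u ^+ 2 - 3 * u - 1) = 0.
Proof.
pose w := [:: (false, false); (true, true); (false, true); (true, false)].
have E : of_word w = of_word ((true, false) :: w ++ [:: (false, true)]).
  rewrite -cat_cons of_word_catg of_word_cons.
  have -> : of_word w = conjugator.
    by rewrite !of_word_cons of_word_nil mulg1 !mulgA.
  rewrite -[of_letter _]/second_meridian -meridians_conjugate.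
  by rewrite of_word_cons of_word_nil mulg1 mulgK.
have uE : I (meridian * second_meridian^-1)%g = u + 1 by rewrite /u subrK.
by rewrite -word_trace_relation -uE -!I_of_word E subrr.
Qed.

Lemma longitude_trace :
  I longitude = x ^+ 2 * (u - 1) ^+ 2 * (x ^+ 2 - u - 3) + 2.
Proof.
have uE : I (meridian * second_meridian^-1)%g = u + 1 by rewrite /u subrK.
by rewrite I_of_word uE word_trace_longitude.
Qed.

Lemma const_fun_zmod : zmod_morphism (@const_fun R X).
Proof. by move=> f g; apply: coordinate_ext. Qed.

Lemma const_fun_monoid : monoid_morphism (@const_fun R X).
Proof. by split=> [|f g]; apply: coordinate_ext. Qed.

HB.instance Definition _ :=
  GRing.isZmodMorphism.Build C CX (@const_fun R X) const_fun_zmod.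
HB.instance Definition _ :=
  GRing.isMonoidMorphism.Build C CX (@const_fun R X) const_fun_monoid.

Local Notation K := (function_field X).
Local Notation tofrac := (@FracField.tofrac CX).

(** The embedding of the constants in the function field. *)
Definition const_field : {rmorphism C -> K} := tofrac \o @const_fun R X.

Lemma two_neq0 : 2 != 0 :> K.
Proof.
by rewrite -(rmorph_nat const_field) fmorph_eq0 pnatr_eq0.
Qed.

Lemma smooth_projective_modelP v : smooth_projective_model v ->
  valuation const_field v /\ exists t, v t = 1.
Proof. by case=> v0 vc vM vD vt; split. Qed.

Lemma fractionP (A : idomainType) (f : {fraction A}) :
  exists n d : A, d != 0 /\ f = FracField.tofrac n / FracField.tofrac d.
Proof.
elim/quotW: f => r; exists r.1, r.2; have d0 := denom_ratioP r; split=> //.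
apply: (canRL (mulfK _)); first by rewrite tofrac_eq0.
unlock FracField.tofrac; rewrite -[LHS]FracField.pi_mul; apply/eqmodP.
rewrite /= FracField.equivfE /FracField.mulf /=.
by rewrite !numden_Ratio ?oner_eq0 ?mulf_neq0 ?oner_neq0// !mulr1 mulrC.
Qed.

Local Notation XK := (tofrac x).
Local Notation UK := (tofrac u).

Lemma trace_polynomial_generated F : trace_polynomial F ->
  exists2 f : CX, (forall p, f p = F (\val p)) &
    generated const_field XK UK (tofrac f).
Proof.
elim=> [a|g|F1 G1 _ [f fF fP] _ [g gG gP]|F1 G1 _ [f fF fP] _ [g gG gP]].
- by exists (const_fun X a) => //; exact: (generated_const const_field).
- exists (I g) => //; rewrite -(of_word_repr g) I_of_word.
  have gen_opp h : generated const_field XK UK (tofrac h) ->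
      generated const_field XK UK (tofrac (- h)).
    move=> hP; rewrite -mulN1r (tofracM (-1) h); apply: generated_mul => //.
    rewrite -(rmorphN1 (@const_fun R X)).
    exact: (generated_const const_field).
  have gen1 : generated const_field XK UK (tofrac 1).
    rewrite -(rmorph1 (@const_fun R X)).
    exact: (generated_const const_field).
  apply: (@word_trace_closed _
    (fun h => generated const_field XK UK (tofrac h))) => //.
  + exact: generated_x.
  + have -> : I (meridian * second_meridian^-1)%g = u + 1 by rewrite /u subrK.
    rewrite (tofracD u 1).
    by apply: generated_add => //; exact: generated_u.
  + move=> h k hP kP; rewrite (tofracD h (- k)).
    by apply: generated_add => //; exact: gen_opp.
  + by move=> h k hP kP; rewrite (tofracM h k); apply: generated_mul.
- exists (f + g); first by move=> p; rewrite -fF -gG.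
  by rewrite (tofracD f g); apply: generated_add.
- exists (f * g); first by move=> p; rewrite -fF -gG.
  by rewrite (tofracM f g); apply: generated_mul.
Qed.

Lemma function_field_fractions (f : K) : exists g h,
  [/\ generated const_field XK UK g, generated const_field XK UK h, h != 0
    & f = g / h].
Proof.
have [n [d [d0 ->]]] := fractionP f.
have gen (h : CX) : generated const_field XK UK (tofrac h).
  have /asboolP[F FP hF] := valP h.
  have [k kF kP] := trace_polynomial_generated FP.
  suff -> : h = k by [].
  apply: coordinate_ext => p.
  by rewrite kF -[RHS]/((fun q => F (\val q)) p) -hF.
by exists (tofrac n), (tofrac d); rewrite tofrac_eq0; split.
Qed.

(** The function [I_gamma] at [gamma = p alpha + q lambda]. *)
Definition Itor (p q : int) : K := tofrac (I (peripheral p q)).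

Lemma Itor00 : Itor 0 0 = 2.
Proof. by rewrite /Itor peripheral0 I1 rmorph_nat. Qed.

Lemma Itor_mul p q p' q' :
  Itor (p + p') (q + q') + Itor (p - p') (q - q') = Itor p q * Itor p' q'.
Proof.
by rewrite /Itor peripheralD peripheralB -rmorphD I_mul_inv rmorphM.
Qed.

Lemma Itor10 : Itor 1 0 = XK.
Proof. by rewrite /Itor peripheral_meridian. Qed.

Lemma f_E p q : f_ X p q = Itor p q ^+ 2 - 4.
Proof. by rewrite /f_ rmorphB rmorphXn rmorph_nat. Qed.

Lemma degree0 : degree (0 : K) = 0%E.
Proof.
rewrite /degree esum1// => v [v0 _ _ _ _].
by rewrite v0 oppr0 maxxx.
Qed.

(** * The degrees of the functions f_(p, q) *)

Section Norm.
Variable N : R * R -> R.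
Hypothesis NP : culler_shalen_norm X N.

Lemma norm_neq0 (p q : int) : degree (f_ X p q) = 0%E -> p = 0 /\ q = 0.
Proof.
have [[_ _ N0] E] := NP; rewrite -E => -[/N0] [/eqP + /eqP].
by rewrite !intr_eq0 => /eqP -> /eqP ->.
Qed.

(** Where [u = 1] the longitude has trace 2, so that [f_ 0 1] would vanish. *)
Lemma canonical_relation : u * x ^+ 2 - u ^+ 2 - 3 * u - 1 = 0.
Proof.
have /eqP := character_relation; rewrite mulf_eq0 => /orP[/eqP u1|/eqP//].
have [] := @norm_neq0 0 1; last by [].
rewrite /f_ peripheral_longitude longitude_trace u1 expr0n mulr0 mul0r add0r.
have -> : 2 ^+ 2 - 4 = 0 :> CX by ring.
by rewrite rmorph0 degree0.
Qed.

Lemma UK_neq0 : UK != 0.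
Proof. by have [] := curve_of_relation tofrac canonical_relation. Qed.

Lemma curve_equation : XK ^+ 2 = UK + 3 + UK^-1.
Proof. by have [] := curve_of_relation tofrac canonical_relation. Qed.

Lemma Itor01 : Itor 0 1 = Itor 1 0 ^+ 4 - 5 * Itor 1 0 ^+ 2 + 2.
Proof.
rewrite Itor10 /Itor peripheral_longitude longitude_trace.
by have [] := curve_of_relation tofrac canonical_relation.
Qed.

Local Notation model := (@smooth_projective_model R X).

(** By this symmetry the poles of [u] are treated as the zeros of [u^-1]. *)
Lemma curve_equation_inv : XK ^+ 2 = UK^-1 + 3 + UK^-1^-1.
Proof. by rewrite invrK curve_equation addrC (addrC UK) addrA. Qed.

Lemma function_field_fractions_inv f : exists g h,
  [/\ generated const_field XK UK^-1 g, generated const_field XK UK^-1 h,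
    h != 0 & f = g / h].
Proof.
have [g [h [gP hP h0 ->]]] := function_field_fractions f.
by exists g, h; split=> //; exact: generated_symm.
Qed.

Lemma UKi_neq0 : UK^-1 != 0.
Proof. by rewrite invr_eq0 UK_neq0. Qed.

Lemma val_UKi v : valuation const_field v -> v UK^-1 = - v UK.
Proof.
move=> vP; have U0 := UK_neq0.
have /(congr1 v) := mulfV U0; rewrite (val_mul vP) ?invr_eq0// (val_nat vP 1).
by move=> /eqP; rewrite addrC addr_eq0 => /eqP.
Qed.

Lemma pole_x v : model v ->
  (v UK > 0 \/ v UK < 0 -> pole v XK = 1) /\ (v UK = 0 -> pole v XK = 0).
Proof.
move=> /smooth_projective_modelP[vP [t vt]].
have vUi := val_UKi vP.
split=> [[vu|vu]|vu].
- have xv := simple_pole UK_neq0 curve_equation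
    function_field_fractions vP vu vt.
  by rewrite pole_neg xv.
- have vu' : 0 < v UK^-1 by rewrite vUi oppr_gt0.
  have xv := simple_pole UKi_neq0 curve_equation_inv
    function_field_fractions_inv vP vu' vt.
  by rewrite pole_neg xv.
- have X2 : vge v 0 (XK ^+ 2).
    rewrite curve_equation; apply: (vgeD vP); last by rewrite /vge vUi vu.
    by apply: (vgeD vP); [rewrite /vge vu|exact: (@vge_nat _ _ _ _ vP 3)].
  apply: (pole_vge0 vP) => /eqP x0.
  have : XK ^+ 2 <> 0 by apply/eqP; rewrite sqrf_eq0.
  by move=> /X2; rewrite (valX vP)//; lia.
Qed.

Lemma pole_f v : model v -> exists2 s : int, s = 1 \/ s = -1 &
  forall p q, pole v (f_ X p q) = 2 * pole v XK * `|p + 4 * s * q|.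
Proof.
move=> /smooth_projective_modelP[vP _].
have [s sE H] := pole_torus vP Itor00 Itor_mul two_neq0 Itor01.
exists s => // p q.
by rewrite f_E (pole_sqr_sub4 vP) H Itor10 mulrA.
Qed.

(** The contribution to the degree of a set [A] of poles of [x] with at most one
  element: [d] is the number of elements, [s] the sign in the order of the
  pole, which is arbitrary if [A] is empty. *)
Lemma esum_pole (A : set (K -> int)) : (A `<=` model)%classic ->
  (forall v, A v -> pole v XK = 1) ->
  (forall v w, A v -> A w -> v = w) ->
  exists d s : int, [/\ d = 0 \/ d = 1, s = 1 \/ s = -1 & forall p q,
    \esum_(v in A) ((pole v (f_ X p q))%:~R)%:E =
      ((2 * d * `|p + 4 * s * q|)%:~R)%:E :> \bar R].
Proof.
move=> Amodel A1 Auniq; have [A0|/set0P[v Av]] := eqVneq A set0.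
  exists 0, 1; split; [by left|by left|move=> p q].
  by rewrite A0 esum_set0 mulr0 mul0r.
have [s sE H] := pole_f (Amodel _ Av); exists 1, s; split=> //; first by right.
move=> p q; have -> : A = [set v]%classic.
  by apply/seteqP; split=> [w Aw|w ->//] /=; exact: Auniq.
by rewrite esum_set1 H A1.
Qed.

Lemma degree_f : exists d s d' s' : int,
  [/\ d = 0 \/ d = 1, s = 1 \/ s = -1, d' = 0 \/ d' = 1, s' = 1 \/ s' = -1
  & forall p q, degree (f_ X p q) =
    ((2 * d * `|p + 4 * s * q| + 2 * d' * `|p + 4 * s' * q|)%:~R)%:E].
Proof.
pose Z := [set v : K -> int | v UK > 0]%classic.
pose P := [set v : K -> int | v UK < 0]%classic.
have [||v w [/smooth_projective_modelP[vP [t vt]] vu]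
    [/smooth_projective_modelP[wP [t' wt]] wu]|d [s [dE sE H]]] :=
    @esum_pole (model `&` Z)%classic.
- by move=> v [].
- by move=> v [vm vu]; apply: (pole_x vm).1; left.
- by apply/funext; exact: (zero_unique UK_neq0 curve_equation
    function_field_fractions vP vu vt wP wu wt).
have [||v w [[/smooth_projective_modelP[vP [t vt]] _] vu]
    [[/smooth_projective_modelP[wP [t' wt]] _] wu]|d' [s' [dE' sE' H']]] :=
    @esum_pole (model `&` ~` Z `&` P)%classic.
- by move=> v [[]].
- by move=> v [[vm _] vu]; apply: (pole_x vm).1; right.
- have vu' : 0 < v UK^-1 by rewrite (val_UKi vP) oppr_gt0.
  have wu' : 0 < w UK^-1 by rewrite (val_UKi wP) oppr_gt0.
  by apply/funext; exact: (zero_unique UKi_neq0 curve_equation_inv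
    function_field_fractions_inv vP vu' vt wP wu' wt).
exists d, s, d', s'; split=> // p q.
pose G v : \bar R := ((pole v (f_ X p q))%:~R)%:E.
have G0 A v : A v -> (0 <= G v)%E.
  by move=> _; rewrite lee_fin ler0z /pole le_max lexx orbT.
have -> : degree (f_ X p q) = \esum_(v in model) G v by [].
rewrite (esumID Z model G (G0 _)) (esumID P (model `&` ~` Z)%classic G (G0 _)).
rewrite (H p q) (H' p q) [X in (_ + (_ + X))%E]esum1 ?adde0 ?intrD//.
move=> v [[vm nZ] nP]; rewrite /G.
have [s0 _ ->] := pole_f vm; rewrite (pole_x vm).2 ?mulr0 ?mul0r//.
by apply/eqP; rewrite eq_le !leNgt; apply/andP; split; apply/negP.
Qed.

Lemma norm_formula p q :
  N (p%:~R, q%:~R) = (2 * (`|p + 4 * q| + `|p - 4 * q|))%:~R.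
Proof.
have [_ NE] := NP.
have [d [s [d' [s' [dE sE dE' sE' H]]]]] := degree_f.
(* the norm does not vanish at (-4 s, 1) and (-4 s', 1) *)
have deg0 r :
    2 * d * `|- (4 * r) + 4 * s * 1| + 2 * d' * `|- (4 * r) + 4 * s' * 1| <> 0.
  by move=> E; have [] := @norm_neq0 (- (4 * r)) 1; rewrite // H E.
have Hs := deg0 s; have Hs' := deg0 s'.
have := NE p q; rewrite H => -[->]; congr (_%:~R).
by case: dE dE' sE sE' Hs Hs' => -> [] -> [] -> [] ->; lia.
Qed.

End Norm.
End CoordinateRing.

Theorem proposition4p10 (R : realType) (X0 : subvariety R)
    (hX0 : canonical_component X0)
    (N : R * R -> R) (hN : culler_shalen_norm X0 N) (p q : int) :
  N (p%:~R, q%:~R) = (2 * (`|p + 4 * q| + `|p - 4 * q|))%:~R.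
Proof. exact: norm_formula hN p q. Qed.
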